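(* Let $C$ be a finite acyclic category and let $F\colon C\to C$ be a functor. Then: (a) $\mathcal{L}_R(F)=\chi\big(R(C)^{R(F)}\big)$; (b) $\mathcal{L}(F)=\chi(C^F)$. Moreover, if $\mathcal{L}_R(F)\neq 0$ or $\mathcal{L}(F)\neq 0$, then there exists at least one object $x$ of $C$ with $F(x)=x$.
   Context: An acyclic (loop-free) category is a small category in which only identity morphisms have inverses and the only morphism from an object to itself is the identity; it is finite if it has finitely many morphisms. The nerve $\Delta(C)$ of an acyclic category $C$ is the regular trisp (generalized simplicial complex, simplices may share vertex sets) whose vertices are the objects of $C$ and which has one $k$-simplex for each chain $x_0\xrightarrow{\alpha_1}x_1\to\cdots\xrightarrow{\alpha_k}x_k$ of $k\ge 1$ composable non-identity morphisms; a functor $F$ induces the map $\Delta(F)$ sending such a chain to $F(x_0)\xrightarrow{F(\alpha_1)}\cdots\xrightarrow{F(\alpha_k)}F(x_k)$. Homology and Euler characteristic $\chi$ of an acyclic category are those of its nerve (a poset is regarded as an acyclic category with one arrow $x\to y$ iff $x\le y$, so its nerve is its order complex); $\chi(\emptyset)=0$. For a self-map $f$ of such a finite complex, the Lefschetz number is $\mathcal{L}(f)=\sum_{i\ge0}(-1)^i\,\mathrm{trace}(H_i(f))$ with rational coefficients. $R(C)$ is the poset on the objects of $C$ with $x\le y$ iff there is a morphism $x\to y$, and $R(F)\colon R(C)\to R(C)$ is the order-preserving map $x\mapsto F(x)$; $R(C)^{R(F)}$ is the subposet of elements fixed by $R(F)$. Define $\mathcal{L}(F)=\mathcal{L}(\Delta(F))$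 and $\mathcal{L}_R(F)=\mathcal{L}(R(F))$. The fixed subcategory $C^F$ is the acyclic category whose objects are the objects $x$ with $F(x)=x$ and whose morphisms are the morphisms $\alpha$ with $F(\alpha)=\alpha$. *)

(* Defs.v *)
From HB Require Import structures.
From mathcomp Require Import all_boot all_order all_algebra.

Unset Implicit Arguments.
Unset Strict Implicit.
Unset Printing Implicit Defensive.

Import GRing.Theory Num.Theory.
Local Open Scope ring_scope.

(* comp g f is the composite g o f (meaningful when tgt f = src g).    *)
Record fincat := FinCat {
  Ob : finType;
  Mor : finType;
  src : Mor -> Ob;
  tgt : Mor -> Ob;
  idm : Ob -> Mor;
  comp : Mor -> Mor -> Mor }.

Arguments src {C} f : rename.
Arguments tgt {C} f : rename.
Arguments idm {C} x : rename.
Arguments comp {C} g f : rename.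

Definition is_category (C : fincat) : Prop :=
  [/\ (forall x : Ob C, src (idm x) = x /\ tgt (idm x) = x),
      (forall f g : Mor C, tgt f = src g ->
          src (comp g f) = src f /\ tgt (comp g f) = tgt g),
      (forall f : Mor C, comp f (idm (src f)) = f /\ comp (idm (tgt f)) f = f) &
      (forall f g h : Mor C, tgt f = src g -> tgt g = src h ->
          comp h (comp g f) = comp (comp h g) f)].

Definition acyclic (C : fincat) : Prop :=
  (forall f : Mor C, src f = tgt f -> f = idm (src f)) /\
  (forall f g : Mor C, tgt f = src g -> tgt g = src f ->
     comp g f = idm (src f) -> comp f g = idm (src g) -> f = idm (src f)).

Definition is_functor (C : fincat) (F0 : Ob C -> Ob C) (F1 : Mor C -> Mor C) : Prop :=
  [/\ (forall f, src (F1 f) = F0 (src f)),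
      (forall f, tgt (F1 f) = F0 (tgt f)),
      (forall x, F1 (idm x) = idm (F0 x)) &
      (forall f g, tgt f = src g -> F1 (comp g f) = comp (F1 g) (F1 f))].

(* Rational chain complex of a finite semi-simplicial set (trisp).    *)
(* k-simplices: elements p of X k with A k p, encoded injectively by   *)
(* code k p : T.  face l c = code of the l-th face (delete vertex l)   *)
(* of a simplex with code c.  A simplicial map is given by its action  *)
(* g on codes; a simplex whose image is not a simplex of the same      *)
(* dimension (it is degenerate, i.e. collapsed) is sent to 0 in the    *)
(* cellular chain map.  Chains are row vectors.                        *)
Section ChainComplex.
Variables (T : eqType) (X : nat -> finType) (A : forall k, pred (X k)).
Variable code : forall k, X k -> T.

Definition cdim (k : nat) := #|A k|.
Definition sx (k : nat) (i : 'I_(cdim k)) : T := code k (@enum_val _ (A k) i).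

Definition bd (face : nat -> T -> T) k : 'M[rat]_(cdim k.+1, cdim k) :=
  \matrix_(i, j) \sum_(l < k.+2) (-1) ^+ l *+ (face l (sx (k.+1) i) == sx k j).

Definition chm (g : T -> T) k : 'M[rat]_(cdim k) :=
  \matrix_(i, j) (g (sx k i) == sx k j)%:R.

Definition cyc (face : nat -> T -> T) k : 'M[rat]_(cdim k) :=
  match k return 'M[rat]_(cdim k) with
  | 0 => 1%:M
  | k'.+1 => kermx (bd face k')
  end.
End ChainComplex.

(* Trace of the map induced by f (acting on row vectors of length n)  *)
(* on the quotient (row space of Z) / (row space of B), B <= Z,       *)
(* computed in the basis given by a complement W of B in Z.           *)
Definition quot_trace n (f : 'M[rat]_n) m p (Z : 'M[rat]_(m, n)) (B : 'M[rat]_(p, n)) : rat :=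
  let W := (Z :\: B)%MS in
  let bW := row_base W in
  let bZ := col_mx bW (row_base B) in
  \tr (lsubmx (bW *m f *m pinvmx bZ)).

Section Invariants.
Variables (T : eqType) (X : nat -> finType) (A : forall k, pred (X k)).
Variable code : forall k, X k -> T.
Variable face : nat -> T -> T.

Definition betti k : rat :=
  (\rank (@cyc T X A code face k))%:R - (\rank (@bd T X A code face k))%:R.

Definition euler N : rat := \sum_(k < N) (-1) ^+ k * betti k.

Definition lefschetz (g : T -> T) N : rat :=
  \sum_(k < N) (-1) ^+ k *
     quot_trace _ (@chm T X A code g k) _ _ (@cyc T X A code face k) (@bd T X A code face k).
End Invariants.

(* Nerve of (a subcategory of) a finite acyclic category.              *)
(* A k-simplex is coded by (x0, [:: a1; ...; ak]) : a chain            *)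
(* x0 -a1-> x1 -> ... -ak-> xk of composable non-identity morphisms.   *)
(* The subcategory with objects PO and morphisms PM (containing the    *)
(* identities of its objects) has as nerve the chains all of whose     *)
(* objects satisfy PO and morphisms satisfy PM.                        *)
Section Nerve.
Variable C : fincat.
Variables (PO : pred (Ob C)) (PM : pred (Mor C)).

Fixpoint nch (x : Ob C) (s : seq (Mor C)) : bool :=
  if s is a :: s' then
    [&& src a == x, a != idm x, PM a, PO (tgt a) & nch (tgt a) s']
  else true.

Definition nX k := (Ob C * k.-tuple (Mor C))%type.
Definition nA k : pred (nX k) := fun p => PO p.1 && nch p.1 (tval p.2).
Definition ncode k (p : nX k) : Ob C * seq (Mor C) := (p.1, tval p.2).
End Nerve.

Definition nface (C : fincat) (l : nat) (p : Ob C * seq (Mor C)) : Ob C * seq (Mor C) :=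
  let: (x, s) := p in
  if l == 0%N then
    (if s is a :: s' then (tgt a, s') else (x, s))
  else if l == size s then (x, take l.-1 s)
  else (x, take l.-1 s ++ comp (nth (idm x) s l) (nth (idm x) s l.-1) :: drop l.+1 s).

Definition nmap (C : fincat) (F0 : Ob C -> Ob C) (F1 : Mor C -> Mor C)
  (p : Ob C * seq (Mor C)) : Ob C * seq (Mor C) := (F0 p.1, map F1 p.2).

(* L(F) = Lefschetz number of Delta(F) on the nerve of C.  The nerve of
   a finite acyclic category has dimension < #|Ob C|. *)
Definition nerve_lefschetz (C : fincat) (F0 : Ob C -> Ob C) (F1 : Mor C -> Mor C) : rat :=
  @lefschetz _ (nX C) (nA C predT predT) (ncode C) (@nface C) (nmap C F0 F1) #|Ob C|.+1.

Definition fixcat_euler (C : fincat) (F0 : Ob C -> Ob C) (F1 : Mor C -> Mor C) : rat :=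
  @euler _ (nX C) (nA C [pred x | F0 x == x] [pred f | F1 f == f])
    (ncode C) (@nface C) #|Ob C|.+1.

Section OrderComplex.
Variables (O : finType) (le : rel O) (P : pred O).
Definition ltr_of (x y : O) := (x != y) && le x y.
Definition oX k := (k.+1).-tuple O.
Definition oA k : pred (oX k) := fun t => sorted ltr_of (tval t) && all P (tval t).
Definition ocode k (t : oX k) : seq O := tval t.
End OrderComplex.

Definition oface (O : Type) (l : nat) (s : seq O) : seq O := take l s ++ drop l.+1 s.

Definition Rle (C : fincat) : rel (Ob C) :=
  fun x y => [exists f : Mor C, (src f == x) && (tgt f == y)].

Definition R_lefschetz (C : fincat) (F0 : Ob C -> Ob C) : rat :=
  @lefschetz _ (oX (Ob C)) (oA (Ob C) (Rle C) predT) (ocode (Ob C)) (@oface (Ob C))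
    (map F0) #|Ob C|.+1.

Definition Rfix_euler (C : fincat) (F0 : Ob C -> Ob C) : rat :=
  @euler _ (oX (Ob C)) (oA (Ob C) (Rle C) [pred x | F0 x == x]) (ocode (Ob C))
    (@oface (Ob C)) #|Ob C|.+1.

(* Main.v *)
Require Import Defs.
From HB Require Import structures.
From mathcomp Require Import all_boot all_order all_algebra.
Import GRing.Theory Num.Theory.
Local Open Scope ring_scope.

Set Implicit Arguments.
Unset Strict Implicit.
Unset Printing Implicit Defensive.

(** Hopf trace formula: the traces of a chain map on chains satisfy
    tr C_(k+1) = tr Z_(k+1) + tr B_k, so the alternating sum of the traces on
    the homology Z_k / B_k telescopes to the alternating sum of the traces on
    chains.  The chain map of a simplicial self-map sends each simplex to a simplex
    or to 0, so its trace on k-chains is the number of fixed k-simplices.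
    A chain is fixed iff all its objects and morphisms are, so the fixed
    simplices form the nerve of the fixed subposet, resp. subcategory. *)

(** * Traces on stable subspaces *)

(** [pinvmx] reads off coordinates in [row_base U], so for [U] stable under [f] this is the trace of
    the restriction of [f] to [U]. *)
Definition restr_trace (F : fieldType) n (f : 'M[F]_n) m (U : 'M[F]_(m, n)) : F :=
  \tr (row_base U *m f *m pinvmx (row_base U)).

(** Writing [b = P *m c] and [c = Q *m b] gives [P *m Q = 1%:M] and [N = Q *m M *m P], and the trace
    is cyclic. [P] and [Q] may be formally rectangular. *)
Lemma mxtrace_basis_change (F : fieldType) n (f : 'M[F]_n) r s (b : 'M[F]_(r, n))
    (c : 'M[F]_(s, n)) M N :
  row_free b -> row_free c -> (b == c)%MS ->
  b *m f = M *m b -> c *m f = N *m c -> \tr M = \tr N.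
Proof.
move=> fb fc /andP[/submxP[P bP] /submxP[Q cQ]] bM cN.
have PQ : P *m Q = 1%:M.
  by apply: (row_free_inj fb); rewrite -mulmxA -cQ -bP mul1mx.
suff -> : N = Q *m M *m P by rewrite -mulmxA mxtrace_mulC -mulmxA PQ mulmx1.
by apply: (row_free_inj fc); rewrite -cN -mulmxA -bP {1}cQ -!mulmxA bM.
Qed.

Lemma restr_traceE (F : fieldType) n (f : 'M[F]_n) m (U : 'M[F]_(m, n)) r
    (b : 'M[F]_(r, n)) M :
  row_free b -> (b == U)%MS -> b *m f = M *m b -> restr_trace f U = \tr M.
Proof.
move=> fb /eqmxP bU bM.
have Ub : (row_base U == b)%MS.
  by apply/eqmxP; apply: eqmx_trans (eq_row_base U) (eqmx_sym bU).
apply: (mxtrace_basis_change (row_base_free U) fb Ub _ bM).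
rewrite mulmxKpV // eq_row_base -bU.
have : (row_base U <= b)%MS by case/andP: Ub.
move/submxP=> [P ->]; rewrite -mulmxA bM mulmxA.
by rewrite submxMl.
Qed.

Lemma mul_row_base (F : fieldType) n (f : 'M[F]_n) m (U : 'M[F]_(m, n)) :
  stablemx U f -> row_base U *m f = row_base U *m f *m pinvmx (row_base U) *m row_base U.
Proof. by move=> sU; rewrite mulmxKpV // !eq_row_base (eqmxMr f (eq_row_base U)). Qed.

(** In a basis of [W] followed by one of [B], the matrix of [f] on [Z] is block triangular, because
    [B] is stable. The upper left block is the map induced on [Z / B]; [W] itself may fail to be
    stable. *)
Lemma restr_traceD (F : fieldType) n (f : 'M[F]_n) m p q
    (Z : 'M[F]_(m, n)) (W : 'M[F]_(p, n)) (B : 'M[F]_(q, n)) :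
  let bZ := col_mx (row_base W) (row_base B) in
  (W :&: B = 0)%MS -> (W + B == Z)%MS -> stablemx Z f -> stablemx B f ->
  row_free bZ /\
  \tr (lsubmx (row_base W *m f *m pinvmx bZ)) = restr_trace f Z - restr_trace f B.
Proof.
move=> bZ WB0 /eqmxP WBZ sZ sB.
have bZE : (bZ :=: Z)%MS.
  apply: eqmx_trans WBZ; apply: eqmx_trans (eqmx_sym (addsmxE _ _)) _.
  exact: adds_eqmx (eq_row_base W) (eq_row_base B).
have fbZ : row_free bZ.
  by rewrite /row_free bZE -WBZ mxrank_disjoint_sum.
split=> //; apply/eqP; rewrite eq_sym subr_eq; apply/eqP.
have bZf : bZ *m f = bZ *m f *m pinvmx bZ *m bZ.
  by rewrite mulmxKpV // (eqmxMr f bZE) bZE.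
rewrite (restr_traceE fbZ _ bZf); last exact/eqmxP.
rewrite -(submxK (bZ *m f *m pinvmx bZ)) mxtrace_block; congr (_ + _).
  by rewrite /ulsubmx !mul_col_mx col_mxKu.
rewrite /drsubmx !mul_col_mx col_mxKd (restr_traceE (row_base_free B) _ (mul_row_base sB));
  last exact/eqmxP/eq_row_base.
(* The image of [B] has zero coordinates along [W], so the lower right block is the matrix [N] of
   [f] on [B]. *)
congr (\tr _); rewrite [in LHS](mul_row_base sB).
set N := (_ *m pinvmx (row_base B)).
have -> : N *m row_base B = row_mx 0 N *m bZ by rewrite mul_row_col mul0mx add0r.
by rewrite mulmxKp // row_mxKr.
Qed.

Lemma quot_traceE n (f : 'M[rat]_n) m p (Z : 'M[rat]_(m, n)) (B : 'M[rat]_(p, n)) :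
  (B <= Z)%MS -> stablemx Z f -> stablemx B f ->
  quot_trace n f m p Z B = restr_trace f Z - restr_trace f B.
Proof.
move=> BZ sZ sB; rewrite /quot_trace.
case: (@restr_traceD _ n f _ _ _ Z (Z :\: B)%MS B) => //; first exact: capmx_diff.
apply/eqmxP; apply: eqmx_trans (addsmx_diff_cap_eq Z B).
by apply: adds_eqmx (eqmx_refl _) (eqmx_sym _); apply/capmx_idPr.
Qed.

Lemma restr_trace1 (F : fieldType) n (f : 'M[F]_n) : restr_trace f (1%:M : 'M_n) = \tr f.
Proof.
rewrite (@restr_traceE _ _ f _ 1%:M _ 1%:M f) ?mul1mx ?mulmx1 ?submx_refl //.
by rewrite row_free_unit unitmx1.
Qed.

(** The kernel of [D] is stable under [f], and [D] identifies the quotient by it with the image of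
    [D], carrying the map induced by [f] to [h]. *)
Lemma mxtrace_ker_im (F : fieldType) m n (D : 'M[F]_(m, n)) (f : 'M_m) (h : 'M_n) :
  f *m D = D *m h -> \tr f = restr_trace f (kermx D) + restr_trace h D.
Proof.
move=> fD.
have sK : stablemx (kermx D) f.
  by apply/sub_kermxP; rewrite -mulmxA fD mulmxA mulmx_ker mul0mx.
set W := (kermx D)^C%MS.
have KW0 : (W :&: kermx D = 0)%MS by rewrite capmxC capmx_compl.
have KW1 : (W + kermx D == (1%:M : 'M_m))%MS.
  by rewrite addsmxC submx1 sub1mx addsmx_compl_full.
have s1 : stablemx 1%:M f by rewrite submx1.
have [fbZ trq] := restr_traceD KW0 KW1 s1 sK.
apply/eqP; rewrite -restr_trace1 addrC -subr_eq -trq; apply/eqP.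
set bZ := col_mx _ _ in fbZ *; set Q := _ *m pinvmx bZ.
have bWf : row_base W *m f = Q *m bZ.
  rewrite mulmxKpV //; have: row_full bZ; last exact: submx_full.
  rewrite -sub1mx; case/andP: KW1 => _ /submx_trans; apply.
  by rewrite -addsmxE addsmxS // eq_row_base.
(* [D] is injective on the complement [W] of its kernel, so it sends a basis of [W] to a basis of
   its image. *)
have rW : \rank (row_base W *m D) = \rank W.
  rewrite -[in RHS](eq_row_base W) -(mxrank_mul_ker (row_base W) D).
  have -> : \rank (row_base W :&: kermx D) = 0%N; last by rewrite addn0.
  by rewrite (cap_eqmx (eq_row_base W) (eqmx_refl _)) KW0 mxrank0.
symmetry; apply: (@restr_traceE _ _ h _ D _ (row_base W *m D)).
- by rewrite /row_free rW.
- rewrite -mxrank_leqif_eq ?submxMl // rW mxrank_compl mxrank_ker subKn //.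
  exact: rank_leq_row.
- have KD : row_base (kermx D) *m D = 0 by apply/sub_kermxP; rewrite eq_row_base.
  rewrite -[LHS]mulmxA -fD mulmxA bWf -{1}[Q]hsubmxK /bZ mul_row_col mulmxDl.
  by rewrite -[rsubmx Q *m _ *m D]mulmxA KD mulmx0 addr0 -mulmxA.
Qed.

(** Here [a], [b], [c] stand for traces (or ranks) on cycles, boundaries and chains; every 0-chain
    is a cycle, hence the condition at 0. *)
Lemma alternating_telescope (R : pzRingType) (a b c : nat -> R) n :
  c 0%N = a 0%N -> (forall k, c k.+1 = a k.+1 + b k) ->
  \sum_(k < n.+1) (-1) ^+ k * (a k - b k) =
  \sum_(k < n.+1) (-1) ^+ k * c k - (-1) ^+ n * b n.
Proof.
move=> c0 cS; elim: n => [|n IHn].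
  by rewrite !big_ord1 c0 mulrBr.
rewrite big_ord_recr IHn [in RHS]big_ord_recr /= cS mulrBr mulrDr.
by rewrite exprS mulN1r !mulNr opprK addrA -!addrA; congr (_ + _); rewrite addrCA.
Qed.

(** * The Hopf trace formula for a complex of coded simplices *)

(** Euler-Poincaré formula: rank-nullity makes the Betti numbers telescope, and the absence of
    [N.+1]-simplices kills the leftover rank. *)
Lemma euler_sum_cdim (T : eqType) (X : nat -> finType) (A : forall k, pred (X k))
    (code : forall k, X k -> T) face N : cdim X A N.+1 = 0%N ->
  euler T X A code face N.+1 = \sum_(k < N.+1) (-1) ^+ k * (cdim X A k)%:R.
Proof.
move=> d0; rewrite /euler /betti.
rewrite (@alternating_telescope _ (fun k => (\rank (cyc T X A code face k))%:R)
  (fun k => (\rank (bd T X A code face k))%:R) (fun k => (cdim X A k)%:R)).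
- suff -> : \rank (bd T X A code face N) = 0%N by rewrite mulr0 subr0.
  by apply/eqP; rewrite -leqn0 -d0 rank_leq_row.
- by rewrite /= mxrank1.
- by move=> k; rewrite /= mxrank_ker -natrD subnK // rank_leq_row.
Qed.

Section AbstractComplex.
Variables (T : eqType) (X : nat -> finType) (A : forall k, pred (X k)).
Variable code : forall k, X k -> T.
Variable face : nat -> T -> T.

Local Notation dm := (@cdim X A).
Local Notation s_ k := (@sx T X A code k).
Local Notation D := (@bd T X A code face).
Local Notation Z := (@cyc T X A code face).

Definition simplex k (t : T) := [exists p, @A k p && (code p == t)].

Lemma simplexP k t : reflect (exists2 p, @A k p & code p = t) (simplex k t).
Proof.
by apply: (iffP existsP) => [[p /andP[Ap /eqP]]|[p Ap <-]]; exists p; rewrite ?Ap ?eqxx.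
Qed.

Lemma simplex_sx k i : simplex k (s_ k i).
Proof. by apply/simplexP; exists (enum_val i) => //; apply: enum_valP. Qed.

Hypothesis code_inj : forall k, injective (@code k).

Lemma sx_inj k : injective (s_ k).
Proof. by move=> i j /code_inj/enum_val_inj. Qed.

Lemma simplex_idx k t : simplex k t -> exists i, t = s_ k i.
Proof. by case/simplexP=> p Ap <-; exists (enum_rank_in Ap p); rewrite /sx enum_rankK_in. Qed.

(** Turns a matrix product into an evaluation at a code; the factor [simplex k t] reflects that
    collapsed simplices go to 0. *)
Lemma sum_sx (R : pzRingType) k t (phi : T -> R) :
  \sum_m (t == s_ k m)%:R * phi (s_ k m) = (simplex k t)%:R * phi t.
Proof.
case: (boolP (simplex k t)) => [/simplex_idx[i ->]|nst].
  rewrite (bigD1 i) //= eqxx big1 ?addr0 // => m nim.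
  by rewrite eq_sym (inj_eq (@sx_inj k)) (negPf nim) mul0r.
rewrite mul0r big1 // => m _; case: eqP nst => [->|_]; last by rewrite mul0r.
by rewrite simplex_sx.
Qed.

(** The entries of the boundary matrix, extended to arbitrary codes so that they make sense at a
    collapsed image [g t]. *)
Definition bdc k (t u : T) : rat := \sum_(l < k.+2) (-1) ^+ l *+ (face l t == u).

Lemma sum_sx_bdc k t (phi : T -> rat) :
  (forall l, (l < k.+2)%N -> simplex k (face l t)) ->
  \sum_m bdc k t (s_ k m) * phi (s_ k m) = \sum_(l < k.+2) (-1) ^+ l * phi (face l t).
Proof.
move=> sf; rewrite /bdc; under eq_bigr do rewrite mulr_suml.
rewrite exchange_big; apply: eq_bigr => l _ /=.
under eq_bigr do rewrite -mulr_natr -mulrA.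
by rewrite -mulr_sumr sum_sx sf // mul1r.
Qed.

Hypothesis face_simplex : forall k t l, simplex k.+1 t -> (l < k.+2)%N -> simplex k (face l t).
Hypothesis face_face : forall k t i j, simplex k.+2 t -> (i < j)%N -> (j < k.+3)%N ->
  face i (face j t) = face j.-1 (face i t).

(* The terms (i, j) with i < j cancel against the terms (j - 1, i). *)
Lemma bdc_bdc k t u : simplex k.+2 t ->
  \sum_(l < k.+3) (-1) ^+ l * bdc k (face l t) u = 0.
Proof.
move=> st; rewrite /bdc.
pose G l' l : rat := (-1) ^+ (l + l') *+ (face l' (face l t) == u).
rewrite (eq_bigr (fun l : 'I_k.+3 => \sum_(l' < k.+2 | (l' < l)%N) G l' l +
    \sum_(l' < k.+2 | (l <= l')%N) G l' l)); last first.
  move=> l _; rewrite mulr_sumr (bigID (fun l' : 'I_k.+2 => (l' < l)%N)) /=.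
  congr (_ + _); last under eq_bigl do rewrite -leqNgt.
    by apply: eq_bigr => l' _; rewrite mulrnAr -exprD.
  by apply: eq_bigr => l' _; rewrite mulrnAr -exprD.
(* The inner range is empty for [l = 0] in the first sum and for [l = k.+2] in the second. Without
   them both sums run over pairs [l <= m]. *)
rewrite big_split /= big_ord_recl big_pred0 // add0r [X in _ + X]big_ord_recr /=.
rewrite [X in _ + (_ + X)]big_pred0 ?addr0; last first.
  by move=> l'; rewrite leqNgt ltn_ord.
rewrite [X in _ + X](exchange_big_dep predT) //= -big_split big1 // => m _.
rewrite -big_split big1 // => l lm; rewrite /G /= /bump /= add1n addSn exprS mulN1r.
have mk : (m.+1 < k.+3)%N := ltn_ord m.
rewrite (@face_face k t l m.+1) //= [(m + l)%N]addnC.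
by rewrite mulNrn addNr.
Qed.

Lemma bd_bd k : D k.+1 *m D k = 0.
Proof.
apply/matrixP=> i j; rewrite !mxE; under eq_bigr do rewrite !mxE.
rewrite (@sum_sx_bdc k.+1 _ (fun t => bdc k t (s_ k j))) ?bdc_bdc ?simplex_sx // => l.
by apply: face_simplex; apply: simplex_sx.
Qed.

(** * The chain map of a simplicial self-map and its traces *)

Variable g : T -> T.
Hypothesis g_face : forall k t l, simplex k.+1 t -> (l < k.+2)%N -> g (face l t) = face l (g t).
(* A collapsed simplex repeats a vertex, at positions p and p + 1: deleting
   either copy gives the same face, and every other face still collapses. *)
Hypothesis g_degenerate : forall k t, simplex k.+1 t -> ~~ simplex k.+1 (g t) ->
  exists2 p, (p < k.+1)%N & face p (g t) = face p.+1 (g t) /\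
    (forall l, (l < k.+2)%N -> l != p -> l != p.+1 -> ~~ simplex k (face l (g t))).

Local Notation f := (@chm T X A code g).

(** The two equal faces have consecutive indices, hence opposite signs, and no other face is a
    simplex, so none equals [u]. *)
Lemma bdc_degenerate k t u : simplex k.+1 t -> ~~ simplex k.+1 (g t) -> simplex k u ->
  bdc k (g t) u = 0.
Proof.
move=> st /(g_degenerate st)[p pk [fpp fl]] su.
have pk1 : (p < k.+2)%N := ltnW pk.
rewrite /bdc (bigD1 (Ordinal pk1)) //= (bigD1 (Ordinal (pk : p.+1 < k.+2)%N)) /=; last first.
  by rewrite -val_eqE /= neq_ltn ltnSn orbT.
rewrite fpp exprS mulN1r mulNrn addrA subrr add0r.
rewrite big1 // => l /andP[lp lp1]; case: eqP su => [<-|//].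
by rewrite (negPf (fl l (ltn_ord l) lp lp1)).
Qed.

(** Both entries equal [bdc k (g t) u]: on the right because [g] commutes with faces, on the left by
    evaluation if [g t] is a simplex and by [bdc_degenerate] if it collapses. *)
Lemma chm_bd k : f k.+1 *m D k = D k *m f k.
Proof.
apply/matrixP=> i j; rewrite !mxE.
under eq_bigr do rewrite !mxE; under [RHS]eq_bigr do rewrite !mxE.
have si := simplex_sx i.
rewrite (@sum_sx _ k.+1 _ (fun t => bdc k t (s_ k j))).
rewrite (@sum_sx_bdc k _ (fun t => (g t == s_ k j)%:R)); last by move=> l; apply: face_simplex.
rewrite -[LHS](_ : bdc k (g (s_ k.+1 i)) (s_ k j) = _).
  by apply: eq_bigr => l _; rewrite (g_face si) // mulr_natr.
case: (boolP (simplex k.+1 _)) => [|nsg]; first by rewrite mul1r.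
by rewrite mul0r bdc_degenerate // simplex_sx.
Qed.

Lemma hopf_trace N : dm N.+1 = 0%N ->
  lefschetz T X A code face g N.+1 = \sum_(k < N.+1) (-1) ^+ k * \tr (f k).
Proof.
move=> d0; have sD k : stablemx (D k) (f k) by rewrite -chm_bd submxMl.
have sZ k : stablemx (Z k) (f k).
  case: k => [|k] /=; first by rewrite submx1.
  by apply/sub_kermxP; rewrite -mulmxA chm_bd mulmxA mulmx_ker mul0mx.
have DZ k : (D k <= Z k)%MS.
  by case: k => [|k] /=; [rewrite submx1 | apply/sub_kermxP/bd_bd].
rewrite /lefschetz; under eq_bigr do rewrite quot_traceE //.
rewrite (@alternating_telescope _ (fun k => restr_trace (f k) (Z k))
  (fun k => restr_trace (f k) (D k)) (fun k => \tr (f k))).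
- have D0 : D N = 0 by apply/eqP; rewrite -mxrank_eq0 -leqn0 -d0 rank_leq_row.
  suff -> : restr_trace (f N) (D N) = 0 by rewrite mulr0 subr0.
  by rewrite /restr_trace D0 row_base0 !mul0mx mxtrace0.
- by rewrite /= restr_trace1.
- by move=> k; rewrite (mxtrace_ker_im (chm_bd k)).
Qed.

Lemma mxtrace_chm k : \tr (f k) = #|[pred p | @A k p && (g (code p) == code p)]|%:R.
Proof.
rewrite /mxtrace; under eq_bigr do rewrite mxE.
rewrite -(big_enum_val (A := @A k) (fun p => (g (code p) == code p)%:R)) /=.
rewrite -sum1_card natr_sum big_mkcondr; apply: eq_bigr => p _ /=.
by case: (g _ == _).
Qed.

(** Common source of (a) and (b): the Hopf formula on the left and Euler-Poincaré on the right both
    count fixed simplices with signs. *)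
Lemma lefschetz_euler_fixed (A' : forall k, pred (X k)) N :
  (forall k p, @A' k p = @A k p && (g (code p) == code p)) -> dm N.+1 = 0%N ->
  lefschetz T X A code face g N.+1 = euler T X A' code face N.+1.
Proof.
move=> A'E d0; rewrite hopf_trace // euler_sum_cdim; last first.
  apply/eqP; rewrite -leqn0 -d0; apply/subset_leq_card/subsetP => p.
  by rewrite !unfold_in A'E => /andP[].
apply: eq_bigr => k _; rewrite mxtrace_chm; congr (_ * _%:R).
by apply: eq_card => p; rewrite !unfold_in /= A'E.
Qed.

End AbstractComplex.

(** * Order complexes *)

Lemma oface0 (O : Type) (x : O) s : oface _ 0 (x :: s) = s.
Proof. by rewrite /oface take0 /= drop0. Qed.

Lemma ofaceS (O : Type) l (x : O) s : oface _ l.+1 (x :: s) = x :: oface _ l s.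
Proof. by []. Qed.

Lemma size_oface (O : Type) l (s : seq O) : (l < size s)%N -> size (oface _ l s) = (size s).-1.
Proof.
move=> ls; rewrite size_cat size_takel ?size_drop 1?ltnW //.
by case: (size s) ls => // n; rewrite ltnS subSS => /subnKC.
Qed.

Lemma oface_oface (O : Type) (s : seq O) i j : (i < j)%N ->
  oface _ i (oface _ j s) = oface _ j.-1 (oface _ i s).
Proof.
elim: s i j => [|x s IHs] [|i] [|j] // ij; first by rewrite ofaceS !oface0.
rewrite !ofaceS IHs //; case: j ij => [|j] //=.
Qed.

Lemma subseq_oface (O : eqType) l (s : seq O) : subseq (oface _ l s) s.
Proof.
elim: s l => [|x s IHs] [|l] //; first by rewrite oface0 subseq_cons.
by rewrite ofaceS /= eqxx.
Qed.

Lemma map_oface (O O' : Type) (f : O -> O') l s : map f (oface _ l s) = oface _ l (map f s).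
Proof. by rewrite /oface map_cat map_take map_drop. Qed.

(** This lemma and [oface_nuniq] supply the two halves of [g_degenerate] for order complexes. *)
Lemma oface_dup (O : eqType) (x0 : O) s p : (p.+1 < size s)%N ->
  nth x0 s p = nth x0 s p.+1 -> oface _ p s = oface _ p.+1 s.
Proof.
elim: s p => [|x s IHs] [|p] //=; last by rewrite ltnS => ps /(IHs _ ps); rewrite !ofaceS => ->.
by case: s {IHs} => // y s _ /= ->; rewrite ofaceS !oface0.
Qed.

Lemma oface_nuniq (O : eqType) (x0 : O) s p l : (p.+1 < size s)%N ->
  nth x0 s p = nth x0 s p.+1 -> l != p -> l != p.+1 -> ~~ uniq (oface _ l s).
Proof.
elim: s p l => [|x s IHs] [|p] [|l] //.
- case: s {IHs} => // y s _ /= -> _; rewrite eqSS; case: l => // l _.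
  by rewrite /= mem_head.
- move=> ps eqp _ _; rewrite oface0; apply/negP => /(uniqP x0) us.
  suff /eqP : p = p.+1 by rewrite ltn_eqF.
  by apply: us => //; rewrite inE // ltnW.
- rewrite /= ltnS !eqSS => ps eqp lp lp1.
  by rewrite -/(oface O l s) negb_and (IHs p) ?orbT.
Qed.

Section OrderComplex.
Variables (O : finType) (le : rel O).
Hypotheses (le_anti : antisymmetric le) (le_trans : transitive le).

Lemma ltr_of_trans : transitive (ltr_of O le).
Proof.
move=> y x z /andP[xy lxy] /andP[yz lyz]; rewrite /ltr_of (le_trans lxy lyz) andbT.
apply: contra_neq xy => xz; apply: le_anti; rewrite lxy xz //.
Qed.

Lemma ltr_of_uniq s : sorted (ltr_of O le) s -> uniq s.
Proof. by apply: (sorted_uniq ltr_of_trans) => x; rewrite /ltr_of eqxx. Qed.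

Lemma simplex_oX k t :
  simplex (oA O le predT) (ocode O) k t = (size t == k.+1) && sorted (ltr_of O le) t.
Proof.
apply/simplexP/andP => [[p /andP[sp _] <-]|[st lt]]; first by rewrite size_tuple eqxx.
by exists (Tuple st) => //; rewrite /oA /= lt all_predT.
Qed.

(** A weak chain fails to be strict only at two equal neighbours; the monotone image of a strict
    chain is a weak chain. *)
Lemma sorted_ltr_of s : sorted le s ->
  ~~ sorted (ltr_of O le) s -> exists x0 p, (p.+1 < size s)%N /\ nth x0 s p = nth x0 s p.+1.
Proof.
case: s => // x s; elim: s x => // y s IHs x /= /andP[xy ps].
rewrite negb_and /ltr_of xy andbT negbK => /orP[/eqP ->|/(IHs _ ps)[x0 [p [ps1 e]]]].
  by exists x, 0%N.
by exists x0, p.+1.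
Qed.

Lemma lefschetz_order_complex (f : O -> O) : {homo f : x y / le x y} ->
  lefschetz _ (oX O) (oA O le predT) (ocode O) (@oface O) (map f) #|O|.+1 =
  euler _ (oX O) (oA O le [pred x | f x == x]) (ocode O) (@oface O) #|O|.+1.
Proof.
move=> fle; apply: lefschetz_euler_fixed.
- by move=> k; apply: val_inj.
- move=> k t l; rewrite !simplex_oX => /andP[/eqP st lt] lk.
  rewrite size_oface ?st //= eqxx (subseq_sorted ltr_of_trans _ lt) //.
  exact: subseq_oface.
- by move=> k t i j _ ij _; apply: oface_oface.
- by move=> k t l _ _; apply: map_oface.
- move=> k t; rewrite !simplex_oX size_map => /andP[st lt]; rewrite st /= => ng.
  have ft : sorted le (map f t).
    rewrite sorted_map; apply: sub_sorted lt => x y /andP[_]; exact: fle.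
  have [x0 [p [ps e]]] := sorted_ltr_of ft ng.
  exists p; first by rewrite size_map (eqP st) in ps.
  split=> [|l _ lp lp1]; first exact: oface_dup e.
  rewrite simplex_oX negb_and; apply/orP; right.
  by apply: contra (oface_nuniq ps e lp lp1); apply: ltr_of_uniq.
- move=> k p; rewrite /oA all_predT andbT; congr (_ && _); rewrite /ocode.
  by elim: (tval p) => //= x s ->; rewrite eqseq_cons.
(* A simplex of dimension [#|O|.+1] would have [#|O| + 2] distinct vertices. *)
apply: eq_card0 => p; rewrite !unfold_in /oA; apply/negP => /andP[/ltr_of_uniq/card_uniqP cp _].
by have := max_card (mem (tval p)); rewrite cp size_tuple ltnNge leqW.
Qed.
End OrderComplex.

(** * Nerves of acyclic categories *)

Local Notation comp := Defs.comp.

Section AcyclicNerve.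
Variables (C : fincat).
Hypotheses (catC : is_category C) (acC : acyclic C).
Implicit Types (x y : Ob C) (a b : Mor C) (s : seq (Mor C)).

Lemma src_comp a b : tgt a = src b -> src (comp b a) = src a.
Proof. by case: catC => _ H _ _ /H[]. Qed.

Lemma tgt_comp a b : tgt a = src b -> tgt (comp b a) = tgt b.
Proof. by case: catC => _ H _ _ /H[]. Qed.

Lemma loop_idm a : src a = tgt a -> a = idm (src a).
Proof. by case: acC => H _; apply: H. Qed.

Lemma comp_loop_r a b : src a = tgt a -> tgt a = src b -> comp b a = b.
Proof. by move=> la ab; rewrite (loop_idm la) la ab; case: catC => _ _ /(_ b)[]. Qed.

Lemma comp_loop_l a b : src b = tgt b -> tgt a = src b -> comp b a = a.
Proof. by move=> lb ab; rewrite (loop_idm lb) -ab; case: catC => _ _ /(_ a)[]. Qed.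

(* Otherwise [comp b a] is an identity, and a and b are mutually inverse. *)
Lemma comp_nonloop a b : tgt a = src b -> src a != tgt a -> src (comp b a) != tgt (comp b a).
Proof.
move=> ab; apply: contra_neq => lba.
have ba : tgt b = src a by rewrite -(tgt_comp ab) -lba src_comp.
have lab : src (comp a b) = tgt (comp a b) by rewrite src_comp // tgt_comp.
rewrite (acC.2 a b ab ba); last by rewrite (loop_idm lab) src_comp.
  by case: catC => /(_ (src a))[-> ->].
by rewrite (loop_idm lba) src_comp.
Qed.

Lemma Rle_trans : transitive (Rle C).
Proof.
move=> y x z /existsP[a /andP[/eqP ax /eqP ay]] /existsP[b /andP[/eqP b_y /eqP bz]].
by apply/existsP; exists (comp b a); rewrite src_comp ?tgt_comp ?ay ?b_y // ax bz !eqxx.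
Qed.

(** A non-loop followed by a morphism back would compose to a loop, against [comp_nonloop]. *)
Lemma Rle_anti : antisymmetric (Rle C).
Proof.
move=> x y /andP[/existsP[a /andP[/eqP <- /eqP <-]] /existsP[b /andP[/eqP ab /eqP ba]]].
apply/eqP; apply: contraT => na; have := comp_nonloop (esym ab) na.
by rewrite src_comp // tgt_comp // ba eqxx.
Qed.

(** * Chains of morphisms and their faces *)

Fixpoint composable x s : bool :=
  if s is a :: s' then (src a == x) && composable (tgt a) s' else true.

(** By acyclicity the identities are exactly the loops, so being a non-identity depends on the
    endpoints alone. *)
Definition nonloop a := src a != tgt a.

(** Separates composability, which every functor preserves, from the condition that may fail for an
    image chain. *)
Lemma nch_composable x s : nch C predT predT x s = composable x s && all nonloop s.
Proof.
elim: s x => //= a s IHs x; rewrite IHs; case: eqP => //= ax; rewrite andbCA; congr (_ && _).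
congr (_ && _); rewrite /nonloop -ax; apply/idP/idP; apply: contra_neq; first exact: loop_idm.
by move=> ->; case: catC => /(_ (src a))[-> ->].
Qed.

Lemma simplex_nX k x s :
  simplex (nA C predT predT) (ncode C) k (x, s) =
  [&& size s == k, composable x s & all nonloop s].
Proof.
apply/simplexP/andP => [[[y p]] /= np [<- <-]|[ss ns]].
  by rewrite size_tuple eqxx -nch_composable.
by exists (x, Tuple ss) => //; rewrite /nA /= nch_composable.
Qed.

(* Deletes vertex l + 1 (not l): vertex 0 changes the base point, see [nface0]. *)
Fixpoint contract l s : seq (Mor C) :=
  match l, s with
  | 0, a :: b :: s' => comp b a :: s'
  | l'.+1, a :: s' => a :: contract l' s'
  | _, _ => [::]
  end.

Lemma nface0 x a s : nface C 0 (x, a :: s) = (tgt a, s).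
Proof. by []. Qed.

(** The fallback case of [contract] drops the final arrow, so inner vertices and the last vertex are
    treated uniformly. *)
Lemma nfaceS l x s : (l < size s)%N -> nface C l.+1 (x, s) = (x, contract l s).
Proof.
rewrite /nface /= => ls; move: (idm x) => d.
suff <- : (if l.+1 == size s then take l s
    else take l s ++ comp (nth d s l.+1) (nth d s l) :: drop l.+2 s) = contract l s.
  by case: ifP.
elim: s l ls => // a s IHs [|l] ls.
  by case: s {IHs ls} => //= b s; rewrite drop0.
by rewrite [RHS]/= -(IHs l ls) /= eqSS; case: ifP.
Qed.

Lemma size_contract l s : (l < size s)%N -> size (contract l s) = (size s).-1.
Proof.
elim: s l => // a s IHs [|l] ls /=; first by case: s {IHs ls}.
by rewrite IHs // prednK //; exact: leq_ltn_trans (leq0n l) ls.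
Qed.

Lemma composable_contract x s l : composable x s -> composable x (contract l s).
Proof.
elim: s l x => [|a s IHs] [|l] x //= /andP[ax cs]; last by rewrite ax IHs.
case: s cs {IHs} => //= b s /andP[/eqP ba cs].
by rewrite src_comp // tgt_comp // ax.
Qed.

Lemma nonloop_contract x s l : composable x s -> all nonloop s -> all nonloop (contract l s).
Proof.
elim: s l x => [|a s IHs] [|l] x //= /andP[ax cs] /andP[na ns]; last by rewrite na (IHs l (tgt a)).
case: s cs ns {IHs} => //= b s /andP[/eqP ba cs] /andP[nb ->].
by rewrite andbT; apply: comp_nonloop.
Qed.

(** The only substantial case is that of two adjacent inner vertices, where it is associativity. *)
Lemma contract_contract x s i j : composable x s -> (i < j)%N -> (j < size s)%N ->
  contract i (contract j s) = contract j.-1 (contract i s).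
Proof.
elim: s x i j => [|a s IHs] x [|i] [|j] //= /andP[/eqP ax cs] ij js; last first.
  by rewrite (IHs (tgt a)) //; case: j ij js.
case: s cs js {IHs} => //= b s /andP[/eqP ba cs].
case: j {ij} => [|j] //=; case: s cs => //= c s /andP[/eqP cb cs] _.
by case: catC => _ _ _ ->.
Qed.

Lemma nface_simplex k t l : simplex (nA C predT predT) (ncode C) k.+1 t -> (l < k.+2)%N ->
  simplex (nA C predT predT) (ncode C) k (nface C l t).
Proof.
case: t => x s; rewrite simplex_nX => /and3P[/eqP ss cs ns].
case: l => [_|l lk].
  by case: s ss cs ns => // a s [ss] /= /andP[_ cs] /andP[_ ns]; rewrite simplex_nX ss eqxx cs.
rewrite nfaceS ?ss // simplex_nX size_contract ?ss // eqxx composable_contract //.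
exact: nonloop_contract cs ns.
Qed.

Lemma nface_nface x s i j : composable x s -> (1 < size s)%N -> (i < j)%N -> (j <= size s)%N ->
  nface C i (nface C j (x, s)) = nface C j.-1 (nface C i (x, s)).
Proof.
case: j => // j cs s2 ij js; rewrite nfaceS //; case: i ij => [|i] ij.
  case: s cs s2 js => // a s /andP[ax cs] s2 js; rewrite nface0 [j.+1.-1]/=.
  case: j ij js => [|j] _ js; last by rewrite nfaceS.
  by case: s cs s2 js => // b s /andP[/eqP ba _] _ _; rewrite !nface0 tgt_comp.
have ijs : (i < size s)%N by apply: leq_trans js; rewrite ltnS ltnW.
case: j ij js => // j ij js; rewrite [j.+2.-1]/=.
have sj : (j < (size s).-1)%N by case: (size s) js.
by rewrite !nfaceS ?size_contract ?(leq_ltn_trans _ sj) // (contract_contract cs).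
Qed.

(** The two deletions remove the two ends of the loop. Each composes it with a neighbour, or drops
    it at the end of the chain, so the loop merely disappears. *)
Lemma contract_loop x a s p : composable x s -> (p.+1 < size s)%N ->
  ~~ nonloop (nth a s p.+1) -> contract p s = contract p.+1 s.
Proof.
elim: s x p => // c s IHs x [|p] /= /andP[_ cs] ps nl; last by rewrite (IHs (tgt c)).
case: s cs ps nl {IHs} => //= d s /andP[/eqP dc cs] _; rewrite negbK => /eqP ld.
rewrite comp_loop_l //; case: s cs => //= e s /andP[/eqP ed _].
by rewrite comp_loop_r.
Qed.

Lemma nface_loop x a s p : composable x s -> (p < size s)%N ->
  ~~ nonloop (nth a s p) -> nface C p (x, s) = nface C p.+1 (x, s).
Proof.
case: p => [|p] cs ps nl; last by rewrite !nfaceS // 1?ltnW // (contract_loop cs ps nl).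
rewrite nfaceS //; case: s cs ps nl => // b s /andP[/eqP <- cs] _; rewrite negbK => /eqP lb.
have {}lb : src b = tgt b := lb.
rewrite nface0 lb; case: s cs => //= c s /andP[/eqP cb _].
by rewrite comp_loop_r.
Qed.

(** [contract l] merges or drops only arrows in positions [l] and [l.+1]; a loop elsewhere
    survives. *)
Lemma contract_has_loop a s p l : (p < size s)%N -> ~~ nonloop (nth a s p) ->
  l != p -> l.+1 != p -> ~~ all nonloop (contract l s).
Proof.
elim: s p l => // b s IHs [|p] [|l] //= ps nl.
- by rewrite negb_and nl.
- move=> _; case: s {IHs} ps nl => [|c s]; first by case: p.
  case: p => // p ps nl _ /=; rewrite negb_and; apply/orP; right.
  by apply/allPn; exists (nth a s p) => //; apply: mem_nth.
- by rewrite !eqSS => lp lp1; rewrite negb_and (IHs p) ?orbT.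
Qed.

Lemma nface_has_loop x a s p l : (p < size s)%N -> ~~ nonloop (nth a s p) ->
  (l <= size s)%N -> l != p -> l != p.+1 -> ~~ all nonloop (nface C l (x, s)).2.
Proof.
case: l => [|l] ps nl ls lp lp1; last by rewrite nfaceS // (contract_has_loop ps nl).
case: s ps nl {ls} => // b s; case: p lp lp1 => // p _ _ ps nl; rewrite nface0.
by apply/allPn; exists (nth a s p) => //; apply: mem_nth.
Qed.

(** The objects of a chain of non-loops increase strictly in [R(C)]; this bounds the dimension of
    the nerve. *)
Lemma chain_uniq x s : composable x s -> all nonloop s -> uniq (x :: map tgt s).
Proof.
move=> cs ns; apply: (ltr_of_uniq Rle_anti Rle_trans).
elim: s x cs ns => //= a s IHs x /andP[/eqP <- cs] /andP[na ns].
rewrite IHs // /ltr_of -/(nonloop a) na /= andbT.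
by apply/existsP; exists a; rewrite !eqxx.
Qed.

Lemma cdim_nX_eq0 : cdim (nX C) (nA C predT predT) #|Ob C|.+1 = 0%N.
Proof.
apply: eq_card0 => -[x t]; rewrite unfold_in /nA /= nch_composable.
apply/negP => /andP[ct nt]; have /card_uniqP := chain_uniq ct nt.
by rewrite /= size_map size_tuple => e; have := max_card (mem (x :: map tgt t)); rewrite e ltnNge leqW.
Qed.

(** * The self-map of the nerve induced by a functor *)

Variables (F0 : Ob C -> Ob C) (F1 : Mor C -> Mor C).
Hypothesis functorF : is_functor C F0 F1.

Lemma composable_functor x s : composable x s -> composable (F0 x) (map F1 s).
Proof.
case: functorF => Fs Ft _ _; elim: s x => //= a s IHs x /andP[/eqP <- /IHs].
by rewrite Fs Ft eqxx.
Qed.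

Lemma map_contract x s l : composable x s -> map F1 (contract l s) = contract l (map F1 s).
Proof.
case: functorF => _ _ _ Fc; elim: s x l => [|a s IHs] x [|l] //= /andP[_ cs].
  by case: s cs {IHs} => //= b s /andP[/eqP ba _]; rewrite Fc.
by rewrite (IHs (tgt a)).
Qed.

Lemma nmap_nface x s l : composable x s -> (0 < size s)%N -> (l <= size s)%N ->
  nmap C F0 F1 (nface C l (x, s)) = nface C l (nmap C F0 F1 (x, s)).
Proof.
case: l => [|l] cs s0 ls.
  case: s {cs ls} s0 => // a s _; case: functorF => _ Ft _ _.
  by rewrite /nmap /= Ft.
by rewrite /nmap !nfaceS ?size_map //= (map_contract _ cs).
Qed.

(** A code records only the base point and the arrows; the other objects are targets of fixed
    arrows, hence fixed too. *)
Lemma nch_fixed x s : nch C predT predT x s -> (F0 x, map F1 s) = (x, s) ->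
  F0 x == x /\ nch C [pred x | F0 x == x] [pred f | F1 f == f] x s.
Proof.
case: functorF => _ Ft _ _; elim: s x => [|a s IHs] x /=; first by move=> _ [->].
move=> /and3P[-> -> ns] [-> Fa Fs]; rewrite Fa eqxx /=; split=> //.
have [|-> ->] := IHs _ ns; last by rewrite eqxx.
by rewrite -Ft Fa Fs.
Qed.

Lemma fixed_nch x s : F0 x == x -> nch C [pred x | F0 x == x] [pred f | F1 f == f] x s ->
  nch C predT predT x s /\ (F0 x, map F1 s) = (x, s).
Proof.
move=> /eqP Fx; elim: s x Fx => [|a s IHs] x Fx /=; first by rewrite Fx.
case/and5P=> -> -> /eqP Fa /eqP Ft /(IHs _ Ft)[-> [_ ->]].
by rewrite Fx Fa.
Qed.

Lemma nA_fixed k p : nA C [pred x | F0 x == x] [pred f | F1 f == f] k p =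
  nA C predT predT k p && (nmap C F0 F1 (ncode C k p) == ncode C k p).
Proof.
case: p => x t; rewrite /nA /nmap /ncode /=; apply/andP/andP => [[Fx /(fixed_nch Fx)[-> ->]]|[nt /eqP]].
  by rewrite eqxx.
by case/(nch_fixed nt).
Qed.

Lemma lefschetz_nerve : nerve_lefschetz C F0 F1 = fixcat_euler C F0 F1.
Proof.
apply: lefschetz_euler_fixed; last exact: cdim_nX_eq0.
- by move=> k [x t] [y u] [-> /val_inj ->].
- exact: nface_simplex.
- move=> k [x s] i j; rewrite simplex_nX => /and3P[/eqP ss cs _] ij jk.
  by rewrite nface_nface ?ss.
- move=> k [x s] l; rewrite simplex_nX => /and3P[/eqP ss cs _] lk.
  by rewrite nmap_nface ?ss.
- move=> k [x s]; rewrite /nmap !simplex_nX size_map => /and3P[ss cs _].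
  (* The image chain is still composable, so it fails to be a simplex only by containing a loop, at
     position [p]. *)
  have cFs := composable_functor cs; rewrite ss cFs => /allPn[a /(nthP a)[p ps <-] nl].
  exists p; first by rewrite size_map (eqP ss) in ps.
  split=> [|l lk lp lp1]; first exact: (nface_loop cFs ps nl).
  have ls : (l <= size (map F1 s))%N by rewrite size_map (eqP ss).
  have := nface_has_loop (F0 x) ps nl ls lp lp1; case: (nface C l _) => y u nu.
  by rewrite simplex_nX (negPf nu) !andbF.
- exact: nA_fixed.
Qed.

Lemma lefschetz_R : R_lefschetz C F0 = Rfix_euler C F0.
Proof.
apply: (lefschetz_order_complex Rle_anti Rle_trans) => x y /existsP[a /andP[/eqP <- /eqP <-]].
by case: functorF => Fs Ft _ _; apply/existsP; exists (F1 a); rewrite Fs Ft !eqxx.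
Qed.
End AcyclicNerve.

(** * Existence of a fixed object *)

Lemma euler_empty (T : eqType) (X : nat -> finType) (A : forall k, pred (X k))
    (code : forall k, X k -> T) face N : (forall k p, A k p = false) ->
  euler T X A code face N.+1 = 0.
Proof.
move=> A0; have d0 k : cdim X A k = 0%N by apply: eq_card0 => p; rewrite unfold_in A0.
by rewrite euler_sum_cdim // big1 // => k _; rewrite d0 mulr0.
Qed.

Unset Implicit Arguments.

Theorem mainTheorem1 (C : fincat) (F0 : Ob C -> Ob C) (F1 : Mor C -> Mor C) :
  is_category C -> acyclic C -> is_functor C F0 F1 ->
  [/\ R_lefschetz C F0 = Rfix_euler C F0,
      nerve_lefschetz C F0 F1 = fixcat_euler C F0 F1 &
      (R_lefschetz C F0 != 0 \/ nerve_lefschetz C F0 F1 != 0) ->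
        exists x : Ob C, F0 x = x].
Proof.
move=> catC acC functorF.
have R_eq := lefschetz_R catC acC functorF.
have N_eq := lefschetz_nerve catC acC functorF.
split=> //; rewrite R_eq N_eq.
(* Without a fixed object no simplex has an admissible first vertex, so both fixed complexes are
   empty and both numbers vanish. *)
case: (pickP [pred x | F0 x == x]) => [x /eqP Fx _|noF]; first by exists x.
have -> : Rfix_euler C F0 = 0.
  apply: euler_empty => k p; rewrite /oA; case: p => [[|x s] ps] //=.
  by have /= -> := noF x; rewrite andbF.
have -> : fixcat_euler C F0 F1 = 0.
  by apply: euler_empty => k [x t]; rewrite /nA; have /= -> := noF x.
by rewrite eqxx => -[].
Qed.
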